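(* Let $N>r>0$ be integers and let $A$ be an invertible complex $N\times N$ lower band matrix of order $r$. Then lower Green generators $p(i),q(i),a(i)$ $(i=1,\dots,N-r)$, $P_{N-r+1}$ of the matrix $A^{-1}$ (where $P_{N-r+1}$ is the $r\times r$ generator with index $N-r+1$) are obtained as follows. 1. By the QR procedure described in the context compute the unitary matrices $U_k$ $(k=1,\dots,N-1)$ together with the diagonal entries and subrows $x_k=R(k,k)$, $k=1,\dots,N$, and $X_k=R(k,k+1:N)$, $k=1,\dots,N-1$, of the upper triangular matrix $R$. Determine $p_U(i),q_U(i),a_U(i)$ $(i=1,\dots,N-r)$ from the partitions $$U_i^*=\begin{pmatrix}p_U(i)&d_U(i)\\ a_U(i)&q_U(i)\end{pmatrix},\quad i=1,\dots,N-r,$$ with $p_U(i),d_U(i),a_U(i),q_U(i)$ of sizes $1\times r,\,1\times 1,\,r\times r,\,r\times 1$, and determine $p_U(i),a_U(i)$ $(i=N-r+1,\dots,N-1)$, of sizes $1\times(N-i+1)$ and $(N-i)\times(N-i+1)$, from the partitions $$U_i^*=\begin{pmatrix}p_U(i)\\ a_U(i)\end{pmatrix},\quad i=N-r+1,\dots,N-1.$$ 2.1. Set $p(N)=P_N=1/x_N$ and for $k=N-1,\dots,N-r+1$ compute $$p(k)=\frac1{x_k}\bigl(p_U(k)-X_kP_{k+1}a_U(k)\bigr),\qquad P_k=\begin{pmatrix}p(k)\\ P_{k+1}a_U(k)\end{pmatrix}.$$ This yields the generator $P_{N-r+1}$. 2.2. Set $q(k)=q_U(k)$, $a(k)=a_U(k)$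 for $k=1,\dots,N-r$, and for $k=N-r,\dots,1$ compute $$p(k)=\frac1{x_k}\bigl(p_U(k)-X_kP_{k+1}a(k)\bigr),\qquad P_k=\begin{pmatrix}p(k)\\ P_{k+1}a(k)\end{pmatrix}.$$
   Context: Notation: $M(i:j,k:l)$ denotes the submatrix of $M$ with rows $i,\dots,j$ and columns $k,\dots,l$ (a single index denotes one row or column, '':'' alone means all indices; empty ranges give empty blocks). $I_k$ is the identity of order $k$. An $N\times N$ matrix $A$ is lower band of order $r$ if $A_{ij}=0$ for $i-j>r$. Lower Green generators. Let $p(i)$ ($1\times r$), $q(i)$ ($r\times1$), $a(i)$ ($r\times r$), $i=1,\dots,N-r$, and an $r\times r$ matrix $p(N-r+1)$ be given. They are lower Green generators (of order $r$) of an $N\times N$ matrix $B$ if, with empty products of $a$'s equal to $I_r$: $B(i,1:r)=p(i)a(i-1)\cdots a(1)$ for $1\le i\le N-r$; $B(i,r+j)=p(i)a(i-1)\cdots a(j+1)q(j)$ for $1\le j<i\le N-r$; $B(N-r+1:N,1:r)=p(N-r+1)a(N-r)\cdots a(1)$; $B(N-r+1:N,r+j)=p(N-r+1)a(N-r)\cdots a(j+1)q(j)$ for $1\le j\le N-r$. In the claim the generator with index $N-r+1$ is denoted $P_{N-r+1}$; the $1\times r$ row $p(N-r+1)$ computed in step 2.1 is only the first row of $P_{N-r+1}$. QR procedure for a lower band matrix $A$ of order $r$: (i) Set $Y_0=A(1:r,1:N)$. (ii) For $k=1,\dots,N-r$: set $\Delta_k=\begin{pmatrix}Y_{k-1}(:,1)\\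 A(k+r,k)\end{pmatrix}$ and choose an $(r+1)\times(r+1)$ unitary matrix $U_k$ and a number $x_k$ with $U_k^*\Delta_k=\begin{pmatrix}x_k\\ 0_{r\times1}\end{pmatrix}$. Compute $Z_k=U_k^*\begin{pmatrix}Y_{k-1}(:,2:N-k+1)\\ A(k+r,k+1:N)\end{pmatrix}$ and partition $Z_k=\begin{pmatrix}X_k\\ Y_k\end{pmatrix}$ with $X_k$ of size $1\times(N-k)$ and $Y_k$ of size $r\times(N-k)$. Set $R(k,k)=x_k$, $R(k,k+1:N)=X_k$. (iii) For $k=N-r+1,\dots,N-1$: set $\Delta_k=Y_{k-1}(:,1)$ and choose an $(N-k+1)\times(N-k+1)$ unitary matrix $U_k$ and a number $x_k$ with $U_k^*\Delta_k=\begin{pmatrix}x_k\\ 0_{(N-k)\times1}\end{pmatrix}$. Compute $Z_k=U_k^*Y_{k-1}(:,2:N-k+1)$ and partition $Z_k=\begin{pmatrix}X_k\\ Y_k\end{pmatrix}$ with $X_k$ of size $1\times(N-k)$ and $Y_k$ of size $(N-k)\times(N-k)$. Set $R(k,k)=x_k$, $R(k,k+1:N)=X_k$. (iv) Set $x_N=Y_{N-1}$, $R(N,N)=x_N$. All entries of $R$ below the diagonal are zero. *)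

(* Defs.v *)
From mathcomp Require Import all_boot all_order all_algebra.
From mathcomp Require Export reals.
From mathcomp.real_closed Require Export complex.

Set Implicit Arguments.
Unset Strict Implicit.
Unset Printing Implicit Defensive.

Import Order.TTheory GRing.Theory Num.Theory.
Local Open Scope ring_scope.
Local Open Scope sesquilinear_scope.

(* Entries and blocks of matrices are addressed with 1-based indices.  An entry
   outside the matrix is 0 by convention; no definition below reads one for the
   indices k it is meant for. *)
Definition ent (C : nzRingType) (m n : nat) (M : 'M[C]_(m, n)) (i j : nat) : C :=
  match (insub i.-1 : option 'I_m), (insub j.-1 : option 'I_n) with
  | Some s, Some t => M s t
  | _, _ => 0
  end.

(* blk M i k m' n' = M(i : i+m'-1, k : k+n'-1), the m' x n' block of M whose
   upper left entry is M(i,k).  The result has the stated size definitionally,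
   whatever the (only provably equal) form of the sizes of M. *)
Definition blk (C : nzRingType) (m n : nat) (M : 'M[C]_(m, n)) (i k m' n' : nat) :
    'M[C]_(m', n') :=
  \matrix_(s < m', t < n') ent M (i + s) (k + t).

Definition lower_band (C : nzRingType) (N r : nat) (A : 'M[C]_N) : Prop :=
  forall i j : 'I_N, (j + r < i)%N -> A i j = 0.

(* aprod a i j = a(i-1) a(i-2) ... a(j+1), which is 1 when i <= j+1. *)
Definition aprod (C : nzRingType) (r : nat) (a : nat -> 'M[C]_r) (i j : nat) :
    'M[C]_r :=
  \prod_(l <- rev (index_iota j.+1 i)) a l.

(* P is the r x r generator of index N-r+1; p, q and a are only used at the
   indices 1, ..., N-r. *)
Definition lower_green_generators (C : nzRingType) (N r : nat)
    (p : nat -> 'rV[C]_r) (q : nat -> 'cV[C]_r) (a : nat -> 'M[C]_r)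
    (P : 'M[C]_r) (B : 'M[C]_N) : Prop :=
  [/\ forall i, (1 <= i <= N - r)%N ->
        blk B i 1 1 r = p i *m aprod a i 0,
      forall i j, (1 <= j < i)%N -> (i <= N - r)%N ->
        blk B i (r + j) 1 1 = p i *m aprod a i j *m q j,
      blk B (N - r + 1) 1 r r = P *m aprod a (N - r + 1) 0
    & forall j, (1 <= j <= N - r)%N ->
        blk B (N - r + 1) (r + j) r 1 = P *m aprod a (N - r + 1) j *m q j].

(* The matrices U_k and Y_k change size at k = N-r, so each sequence is split:
   - U k  is U_k for 1 <= k <= N-r      (order r+1),
   - V k  is U_k for N-r+1 <= k <= N-1  (order N-k+1),
   - Y k  is Y_k for 0 <= k <= N-r      (size r x (N-k)),
   - Y' k is Y_k for N-r <= k <= N-1    (order N-k),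
   the last two agreeing at k = N-r.  The numbers x_k and rows X_k are read off
   T, the upper triangular factor: x_k = T(k,k) and X_k = T(k,k+1:N). *)
Definition xdiag (C : nzRingType) (N : nat) (T : 'M[C]_N) (k : nat) : C :=
  ent T k k.

Definition Xrow (C : nzRingType) (N : nat) (T : 'M[C]_N) (k : nat) :
    'rV[C]_(N - k) :=
  blk T k k.+1 1 (N - k).

Record qr_procedure (C : numClosedFieldType) (N r : nat) (A : 'M[C]_N)
    (U : nat -> 'M[C]_(r + 1)) (V : forall k, 'M[C]_((N - k).+1))
    (Y : forall k, 'M[C]_(r, N - k)) (Y' : forall k, 'M[C]_(N - k))
    (T : 'M[C]_N) : Prop := QRProcedure {
  qr_init : Y 0%N = blk A 1 1 r (N - 0);
  qr_head : forall k, (1 <= k <= N - r)%N ->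
    let Delta : 'cV_(r + 1) :=
      col_mx (blk (Y k.-1) 1 1 r 1) (blk A (k + r) k 1 1) in
    let Z : 'M_(r + 1, N - k) :=
      (U k)^t* *m col_mx (blk (Y k.-1) 1 2 r (N - k))
                         (blk A (k + r) k.+1 1 (N - k)) in
    [/\ U k \is unitarymx,
        blk ((U k)^t* *m Delta) 1 1 1 1 = (xdiag T k)%:M,
        blk ((U k)^t* *m Delta) 2 1 r 1 = 0,
        blk Z 1 1 1 (N - k) = Xrow T k
      & blk Z 2 1 r (N - k) = Y k];
  qr_switch : Y' (N - r)%N = blk (Y (N - r)%N) 1 1 (N - (N - r)) (N - (N - r));
  qr_tail : forall k, (N - r + 1 <= k <= N - 1)%N ->
    let Delta : 'cV_((N - k).+1) := blk (Y' k.-1) 1 1 (N - k).+1 1 in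
    let Z : 'M_((N - k).+1, N - k) :=
      (V k)^t* *m blk (Y' k.-1) 1 2 (N - k).+1 (N - k) in
    [/\ V k \is unitarymx,
        blk ((V k)^t* *m Delta) 1 1 1 1 = (xdiag T k)%:M,
        blk ((V k)^t* *m Delta) 2 1 (N - k) 1 = 0,
        blk Z 1 1 1 (N - k) = Xrow T k
      & blk Z 2 1 (N - k) (N - k) = Y' k];
  qr_last : xdiag T N = ent (Y' (N - 1)%N) 1 1;
  qr_lower : forall i j : 'I_N, (j < i)%N -> T i j = 0
}.

(* Blocks of U_k^* for k <= N-r; the 1 x 1 block d_U(k) is never used. *)
Definition pU (C : numClosedFieldType) (r : nat) (U : nat -> 'M[C]_(r + 1))
    (k : nat) : 'rV[C]_r := blk ((U k)^t*) 1 1 1 r.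

Definition aU (C : numClosedFieldType) (r : nat) (U : nat -> 'M[C]_(r + 1))
    (k : nat) : 'M[C]_r := blk ((U k)^t*) 2 1 r r.

Definition qU (C : numClosedFieldType) (r : nat) (U : nat -> 'M[C]_(r + 1))
    (k : nat) : 'cV[C]_r := blk ((U k)^t*) 2 (r + 1) r 1.

(* Blocks of U_k^* for k >= N-r+1. *)
Definition pV (C : numClosedFieldType) (N : nat)
    (V : forall k, 'M[C]_((N - k).+1)) (k : nat) : 'rV[C]_((N - k).+1) :=
  blk ((V k)^t*) 1 1 1 (N - k).+1.

Definition aV (C : numClosedFieldType) (N : nat)
    (V : forall k, 'M[C]_((N - k).+1)) (k : nat) :
    'M[C]_(N - k, (N - k).+1) :=
  blk ((V k)^t*) 2 1 (N - k) (N - k).+1.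

(* Ptail m is P_{N-m}, for 0 <= m < r: the backward recursion for P_k starts at
   k = N and is run on the row count m+1 = N-k+1 of P_k.  The blk's from (1,1)
   only convert N-k to m. *)
Fixpoint Ptail (C : numClosedFieldType) (N : nat)
    (V : forall k, 'M[C]_((N - k).+1)) (T : 'M[C]_N) (m : nat) : 'M[C]_m.+1 :=
  match m return 'M[C]_m.+1 with
  | 0 => ((xdiag T N)^-1)%:M
  | m'.+1 =>
      let k := (N - m'.+1)%N in
      let Pa : 'M[C]_(m'.+1, m'.+2) :=
        Ptail V T m' *m blk (aV V k) 1 1 m'.+1 m'.+2 in
      let p : 'rV[C]_(m'.+2) :=
        (xdiag T k)^-1 *: (blk (pV V k) 1 1 1 m'.+2
                           - blk (Xrow T k) 1 1 1 m'.+1 *m Pa) in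
      col_mx p Pa
  end.

(* The r x r generator P_{N-r+1}, for r > 0. *)
Definition gen_P (C : numClosedFieldType) (N r : nat)
    (V : forall k, 'M[C]_((N - k).+1)) (T : 'M[C]_N) : 'M[C]_r :=
  blk (Ptail V T r.-1) 1 1 r r.

(* Phead n is P_{N-r+1-n}, of size (n+r) x r, for 0 <= n <= N-r. *)
Fixpoint Phead (C : numClosedFieldType) (N r : nat)
    (U : nat -> 'M[C]_(r + 1)) (V : forall k, 'M[C]_((N - k).+1))
    (T : 'M[C]_N) (n : nat) : 'M[C]_(n + r, r) :=
  match n return 'M[C]_(n + r, r) with
  | 0 => gen_P r V T
  | n'.+1 =>
      let k := (N - r + 1 - n'.+1)%N in
      let Pa : 'M[C]_(n' + r, r) := Phead U V T n' *m aU U k in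
      let p : 'rV[C]_r :=
        (xdiag T k)^-1 *: (pU U k - blk (Xrow T k) 1 1 1 (n' + r) *m Pa) in
      col_mx p Pa
  end.

(* p(k), the first row of P_k, for 1 <= k <= N-r. *)
Definition gen_p (C : numClosedFieldType) (N r : nat)
    (U : nat -> 'M[C]_(r + 1)) (V : forall k, 'M[C]_((N - k).+1))
    (T : 'M[C]_N) (k : nat) : 'rV[C]_r :=
  blk (Phead U V T (N - r + 1 - k)) 1 1 1 r.

(* Main.v *)
Require Import Defs.
From mathcomp Require Import all_boot all_order all_algebra zify.

Set Implicit Arguments.
Unset Strict Implicit.
Unset Printing Implicit Defensive.

Import Order.TTheory GRing.Theory Num.Theory.
Local Open Scope ring_scope.
Local Open Scope sesquilinear_scope.

(** Pad each U_k^* by identities to an N x N matrix D_k acting on the window of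
    rows k, ..., min(k+r, N).  The QR procedure then reads S_0 = A,
    S_k = D_k S_{k-1}.  Its invariant: the first k rows of S_k are those of R,
    the columns 1, ..., k of S_k vanish below the diagonal, and the trailing
    block of S_k consists of Y_k on top of the rows of A with index > k+r, which
    no window has reached yet; for these rows the band condition makes the
    elimination of column k automatic ([elim_col_zero], [qr_head_state],
    [qr_tail_state], [qr_step]).  In particular S_{N-1} = R ([qr_elim]), so the
    triangular matrix R is invertible along with A and no x_k vanishes.
    Conversely, choosing at each step a unitary matrix that reflects the current
    column onto the first axis produces a run of the procedure ([qr_exists]).

    Put H_k = S_k^{-1}.  Then H_0 = A^{-1} and H_{k-1} = H_k D_k ([inv_step]).
    The first k columns of H_k vanish below the diagonal ([inv_zero]), so in the
    rows below k the product H_k D_k only sees U_k^* without its first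
    row, that is a_U(k) and q_U(k) ([inv_cols]); row k of H_{k-1} follows from
    S_k H_{k-1} = D_k, since row k of S_k is (0 x_k X_k) ([inv_first_row]).
    These two facts are the recursions for P_k.  Hence, for k <= N-r,
    P_{k+1} = H_k(k+1:N, k+1:k+r) ([Ptail_inv], [Phead_inv]).

    Going from H_0 to H_k in the rows below k, the r leading window columns
    collect the product a(k)...a(j+1) ([inv_cols_aprod]), and column r+j of
    A^{-1}, unchanged by the steps before j, becomes H_j(:, j+1:j+r) q(j)
    ([inv_col_q]).  With the description of P_{k+1} these are the formulas
    that define lower Green generators. *)

(** * Entries and blocks with indices starting at 1 *)

Section Entries.
Variable C : nzRingType.

Lemma ent_ord m n (M : 'M[C]_(m, n)) (s : 'I_m) (t : 'I_n) : ent M s.+1 t.+1 = M s t.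
Proof. by rewrite /ent /= !valK. Qed.

(** Two entries are compared through their indices, since two occurrences of a
    matrix may carry different inferred ring structures. *)
Lemma eq_ent m n (M : 'M[C]_(m, n)) i j i' j' :
  i = i' -> j = j' -> ent M i j = ent M i' j'.
Proof. by move=> -> ->. Qed.

Lemma eq_blk m n (M : 'M[C]_(m, n)) i k i' k' m' n' :
  i = i' -> k = k' -> blk M i k m' n' = blk M i' k' m' n'.
Proof. by move=> -> ->. Qed.

Lemma ent_out_row m n (M : 'M[C]_(m, n)) i j : (m <= i.-1)%N -> ent M i j = 0.
Proof. by move=> lt_mi; rewrite /ent insubF //; lia. Qed.

Lemma ent_out_col m n (M : 'M[C]_(m, n)) i j : (n <= j.-1)%N -> ent M i j = 0.
Proof.
by move=> lt_nj; rewrite /ent [insub j.-1]insubF; [case: insubP | lia].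
Qed.

Lemma ent0 m n i j : ent (0 : 'M[C]_(m, n)) i j = 0.
Proof. by rewrite /ent; case: insubP => *; [case: insubP => *|]; rewrite ?mxE. Qed.

Lemma ent_matrix m n (f : nat -> nat -> C) i j : (0 < i <= m)%N -> (0 < j <= n)%N ->
  ent (\matrix_(s < m, t < n) f s.+1 t.+1) i j = f i j.
Proof.
case: i j => [|i] [|j] //= lt_im lt_jn.
by rewrite -[ i]/(nat_of_ord (Ordinal lt_im)) -[j]/(nat_of_ord (Ordinal lt_jn)) ent_ord mxE.
Qed.

Lemma ent_blk m n (M : 'M[C]_(m, n)) i k m' n' s t :
  (0 < s <= m')%N -> (0 < t <= n')%N ->
  ent (blk M i k m' n') s t = ent M (i + s.-1) (k + t.-1).
Proof. by move=> hs ht; rewrite -(ent_matrix (fun s t => ent M (i + s.-1) (k + t.-1)) hs ht). Qed.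

Lemma entP m n (A B : 'M[C]_(m, n)) :
  (forall i j, (0 < i <= m)%N -> (0 < j <= n)%N -> ent A i j = ent B i j) <-> A = B.
Proof.
split=> [eqAB|-> //]; apply/matrixP => s t.
by rewrite -!ent_ord eqAB //=.
Qed.

Lemma ent_scalar n (a : C) i j : (0 < i <= n)%N -> (0 < j <= n)%N ->
  ent (a%:M : 'M_n) i j = a *+ (i == j).
Proof.
move=> hi hj; rewrite -(ent_matrix (fun i j => a *+ (i == j)) hi hj).
by congr ent; apply/matrixP => s t; rewrite !mxE.
Qed.

Lemma ent_mul m n p (A : 'M[C]_(m, n)) (B : 'M[C]_(n, p)) i j :
  ent (A *m B) i j = \sum_(t < n) ent A i t.+1 * ent B t.+1 j.
Proof.
rewrite {1}/ent; case: insubP => [s _ /= si|nlt_i]; last first.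
  by rewrite big1 // => t _; rewrite /ent insubN // mul0r.
case: insubP => [u _ /= uj|nlt_j]; last first.
  by rewrite big1 // => t _; rewrite /ent [insub j.-1]insubN // /= valK mulr0.
rewrite mxE; apply: eq_bigr => t _; congr (_ * _).
  by rewrite -ent_ord /ent /= si.
by rewrite -ent_ord /ent /= uj.
Qed.

Lemma ent_sub m n (A B : 'M[C]_(m, n)) i j : ent (A - B) i j = ent A i j - ent B i j.
Proof. by rewrite /ent; case: insubP => *; [case: insubP => *|]; rewrite ?subr0 ?mxE. Qed.

Lemma ent_scale m n a (A : 'M[C]_(m, n)) i j : ent (a *: A) i j = a * ent A i j.
Proof. by rewrite /ent; case: insubP => *; [case: insubP => *|]; rewrite ?mulr0 ?mxE. Qed.

Lemma ent_tr m n (A : 'M[C]_(m, n)) i j : ent A^T i j = ent A j i.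
Proof. by rewrite /ent; case: insubP => *; case: insubP => *; rewrite ?mxE. Qed.

Lemma ent_col_mx m1 m2 n (A : 'M[C]_(m1, n)) (B : 'M_(m2, n)) i j : (0 < i)%N ->
  ent (col_mx A B) i j = if (i <= m1)%N then ent A i j else ent B (i - m1) j.
Proof.
case: i => // i _; case: (ltnP j.-1 n) => [lt_jn|]; last by move=> ?; rewrite !ent_out_col ?if_same.
rewrite -[ent _ i.+1 j]/(ent _ i.+1 (Ordinal lt_jn).+1) -[ent B _ j]/(ent B _ (Ordinal lt_jn).+1).
case: (ltnP i m1) => [lt_im|le_mi].
  rewrite -[LHS]/(ent _ (lshift m2 (Ordinal lt_im)).+1 _) ent_ord col_mxEu.
  by rewrite -ent_ord.
case: (ltnP i (m1 + m2)) => [lt_im|le_mmi]; last by rewrite !ent_out_row //; lia.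
have lt_i : (i - m1 < m2)%N by lia.
rewrite subSn // -[RHS]/(ent B (Ordinal lt_i).+1 _) ent_ord -(col_mxEd A) -ent_ord /=.
by rewrite subnKC.
Qed.

Lemma blk_blk m n (M : 'M[C]_(m, n)) i k m1 n1 i' k' m' n' :
  (0 < i')%N -> (0 < k')%N -> (i' + m' <= m1.+1)%N -> (k' + n' <= n1.+1)%N ->
  blk (blk M i k m1 n1) i' k' m' n' = blk M (i + i'.-1) (k + k'.-1) m' n'.
Proof.
move=> hi hk hm hn; apply/entP => s t hs ht.
by rewrite !ent_blk //; [congr ent | |]; lia.
Qed.

Lemma blk11 m n (M : 'M[C]_(m, n)) i j : blk M i j 1 1 = (ent M i j)%:M.
Proof.
apply/entP => s t hs ht; rewrite ent_blk // ent_scalar //.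
have [-> ->] : s = 1%N /\ t = 1%N by lia.
by rewrite /= !addn0.
Qed.

Lemma sum_window (N k w : nat) (F : nat -> C) : (k + w <= N)%N ->
  \sum_(t < N | (k <= t < k + w)%N) F t = \sum_(t < w) F (k + t)%N.
Proof.
move=> le_N; rewrite -[RHS](big_mkord xpredT (fun t => F (k + t)%N)).
rewrite -{2}[w](addKn k) -(add0n (_ - _)%N).
under [RHS]eq_bigr do rewrite addnC.
rewrite add0n -(big_addn 0 _ k xpredT) (big_nat_widen _ _ _ _ _ le_N) big_geq_mkord.
by apply: eq_bigl => t; rewrite andbC.
Qed.

Lemma aprodS r k j (a : nat -> 'M[C]_r) : (j <= k)%N ->
  aprod a k.+2 j = a k.+1 *m aprod a k.+1 j.
Proof.
move=> le_jk; rewrite /aprod /index_iota.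
rewrite (_ : k.+2 - j.+1 = (k.+1 - j.+1) + 1)%N; last by lia.
rewrite iotaD rev_cat /= (_ : j.+1 + (k.+1 - j.+1) = k.+1)%N; last by lia.
by rewrite big_cons.
Qed.

End Entries.

(** * Square matrices acting on a window of rows *)

Section Embedding.
Variables (C : comNzRingType) (N : nat).

(** [emb k u] is diag(I, u, I) of order N, the block u occupying the rows and
    columns k, ..., k + w - 1.  The entrywise form avoids casts between N and
    (k - 1) + w + rest. *)
Definition emb (w k : nat) (u : 'M[C]_w) : 'M[C]_N :=
  \matrix_(i < N, j < N)
    if (k <= i.+1 < k + w)%N && (k <= j.+1 < k + w)%N
    then ent u (i.+1 - k).+1 (j.+1 - k).+1 else (i.+1 == j.+1)%:R.

Lemma ent_emb w k (u : 'M[C]_w) i j : (0 < i <= N)%N -> (0 < j <= N)%N ->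
  ent (emb k u) i j =
    if (k <= i < k + w)%N && (k <= j < k + w)%N
    then ent u (i - k).+1 (j - k).+1 else (i == j)%:R.
Proof.
move=> hi hj; exact: (ent_matrix (fun i j => if (k <= i < k + w)%N && (k <= j < k + w)%N
    then ent u (i - k).+1 (j - k).+1 else (i == j)%:R)).
Qed.

Lemma ent_emb_mul w k (u : 'M[C]_w) n (M : 'M[C]_(N, n)) i j :
  (0 < k)%N -> (k + w <= N.+1)%N -> (0 < i <= N)%N ->
  ent (emb k u *m M) i j =
    if (k <= i < k + w)%N then \sum_(t < w) ent u (i - k).+1 t.+1 * ent M (k + t) j
    else ent M i j.
Proof.
move=> hk hw hi; rewrite ent_mul.
case: ifP => win; last first.
  have lt_i : (i.-1 < N)%N by lia.
  rewrite (bigD1 (Ordinal lt_i)) //= big1 => [|t ne_t].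
    by rewrite ent_emb ?prednK ?win ?eqxx ?mul1r ?addr0 //; lia.
  rewrite ent_emb ?win //=; case: eqP => [eq_i|]; last by rewrite mul0r.
  by case/eqP: ne_t; apply: val_inj => /=; lia.
transitivity (\sum_(t < N | (k.-1 <= t < k.-1 + w)%N)
                ent u (i - k).+1 (t.+1 - k).+1 * ent M t.+1 j).
  rewrite [RHS]big_mkcond; apply: eq_bigr => t _.
  rewrite ent_emb ?win //=.
  have -> : (k <= t.+1 < k + w)%N = (k.-1 <= t < k.-1 + w)%N by lia.
  case: ifP => // nwin; case: eqP => [eq_i|]; last by rewrite mul0r.
  by lia.
rewrite (sum_window (fun t => ent u (i - k).+1 (t.+1 - k).+1 * ent M t.+1 j)); last by lia.
by apply: eq_bigr => t _; congr (_ * _); congr ent; lia.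
Qed.

Lemma emb_tr w k (u : 'M[C]_w) : (emb k u)^T = emb k u^T.
Proof.
apply/entP => i j hi hj; rewrite ent_tr !ent_emb // ent_tr andbC eq_sym.
by case: ifP.
Qed.

Lemma ent_mul_emb w k (u : 'M[C]_w) n (M : 'M[C]_(n, N)) i j :
  (0 < k)%N -> (k + w <= N.+1)%N -> (0 < j <= N)%N ->
  ent (M *m emb k u) i j =
    if (k <= j < k + w)%N then \sum_(t < w) ent M i (k + t) * ent u t.+1 (j - k).+1
    else ent M i j.
Proof.
move=> hk hw hj; rewrite -ent_tr trmx_mul emb_tr ent_emb_mul //.
case: ifP => _; last by rewrite ent_tr.
by apply: eq_bigr => t _; rewrite !ent_tr mulrC.
Qed.

Lemma blk_emb_mul w k (u : 'M[C]_w) n (M : 'M[C]_(N, n)) c n' :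
  (0 < k)%N -> (k + w <= N.+1)%N ->
  blk (emb k u *m M) k c w n' = u *m blk M k c w n'.
Proof.
move=> hk hw; apply/entP => s t hs ht.
rewrite ent_blk // ent_emb_mul //; last by lia.
rewrite ifT ?ent_mul; last by lia.
by apply: eq_bigr => l _; rewrite ent_blk //; [congr (_ * _); congr ent; lia | exact: ltn_ord].
Qed.

Lemma emb_mul w k (u v : 'M[C]_w) : (0 < k)%N -> (k + w <= N.+1)%N ->
  emb k u *m emb k v = emb k (u *m v).
Proof.
move=> hk hw; apply/entP => i j hi hj; rewrite ent_emb_mul // !ent_emb //.
case winI: (k <= i < k + w)%N => //=; case: ifP => winJ.
  rewrite ent_mul; apply: eq_bigr => t _; rewrite ent_emb //; last by have := ltn_ord t; lia.
  rewrite winJ ifT; last by have := ltn_ord t; lia.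
  by congr (_ * _); congr ent; lia.
rewrite big1 => [|t _]; first by case: eqP => // eq_ij; lia.
rewrite ent_emb //; last by have := ltn_ord t; lia.
rewrite winJ andbF; case: eqP => [eq_j|]; last by rewrite mulr0.
by have := ltn_ord t; lia.
Qed.

Lemma emb1 w k : emb k (1%:M : 'M[C]_w) = 1%:M.
Proof.
apply/entP => i j hi hj; rewrite ent_emb // [RHS]ent_scalar //.
case: ifP => // win; rewrite ent_scalar; [congr (_ *+ nat_of_bool _) | |]; by lia.
Qed.

End Embedding.

Lemma emb_unit (C : comUnitRingType) N w k (u : 'M[C]_w) : (0 < k)%N -> (k + w <= N.+1)%N ->
  u \in unitmx -> emb N k u \in unitmx.
Proof.
move=> hk hw Uu; apply: (proj1 (mulmx1_unit (B := emb N k (invmx u)) _)).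
by rewrite emb_mul // mulmxV // emb1.
Qed.

(** Orthonormalising a family of rows that starts with v^* gives a unitary W
    for which v^* is a multiple of the first row; the other rows of W are
    orthogonal to v^*, so W v is supported on the first coordinate, and U = W^* works. *)
Lemma exists_unitary_reflector (C : numClosedFieldType) n (v : 'cV[C]_n) :
  exists U : 'M[C]_n, (U \is unitarymx) &&
    [forall i : 'I_n, (0 < i)%N ==> ((U^t* *m v) i 0 == 0)].
Proof.
pose A := \matrix_(i < n) (if i == 0%N :> nat then v^t* else 0 : 'rV_n).
have UW : schmidt A \is unitarymx by exact: schmidt_unitarymx.
exists ((schmidt A)^t*); rewrite trmxC_unitary UW /=.
apply/forallP => i; apply/implyP => i_gt0; rewrite trmxCK.
have n_gt0 : (0 < n)%N by case: n i {v A UW i_gt0} => // -[].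
have := row_schmidt_sub A (Ordinal n_gt0).
rewrite rowK /= => sub; have {sub} : (v^t* <= row (Ordinal n_gt0) (schmidt A))%MS.
  apply: (submx_trans sub); apply/sumsmx_subP => k; rewrite leqn0 => /eqP k0.
  by have -> : k = Ordinal n_gt0 by [apply: val_inj]; rewrite genmxE.
case/sub_rVP => c vE.
have -> : v = c^* *: (row (Ordinal n_gt0) (schmidt A))^t*.
  rewrite -[LHS]trmxCK vE; apply/matrixP => a b; rewrite !mxE; exact: rmorphM.
rewrite -scalemxAr mxE.
have /row_unitarymxP/(_ i (Ordinal n_gt0)) := UW.
rewrite dotmxE -row_mul mxE => ->.
by rewrite -val_eqE /= eqn0Ngt i_gt0 mulr0.
Qed.

(** * The QR procedure as elimination on N x N matrices *)

Section Elimination.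
Variables (C : numClosedFieldType) (N r : nat).
Hypotheses (r_gt0 : (0 < r)%N) (lt_rN : (r < N)%N).
Implicit Types (U : nat -> 'M[C]_(r + 1)) (V : forall k, 'M[C]_((N - k).+1)).

(** The matrix D_k, with the window cut off at row N once k > N - r. *)
Definition stepmx U V k : 'M[C]_N :=
  if (k <= N - r)%N then emb N k ((U k)^t*) else emb N k ((V k)^t*).

Definition step_width k := if (k <= N - r)%N then (r + 1)%N else (N - k).+1.

(** The entries of U_k^* independently of its order, which jumps at k = N - r;
    this lets the two phases of the procedure share their proofs. *)
Definition step_ent U V k : nat -> nat -> C :=
  if (k <= N - r)%N then ent ((U k)^t*) else ent ((V k)^t*).

(** The matrix S_k = D_k ... D_1 A. *)
Fixpoint elim (A : 'M[C]_N) U V k : 'M[C]_N :=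
  if k is k'.+1 then stepmx U V k *m elim A U V k' else A.

Lemma step_width_le k : (k <= N)%N -> (k + step_width k <= N.+1)%N.
Proof. by rewrite /step_width; case: ifP; lia. Qed.

Lemma ent_stepmx U V k i j : (0 < i <= N)%N -> (0 < j <= N)%N ->
  ent (stepmx U V k) i j =
    if (k <= i < k + step_width k)%N && (k <= j < k + step_width k)%N
    then step_ent U V k (i - k).+1 (j - k).+1 else (i == j)%:R.
Proof.
by move=> hi hj; rewrite /stepmx /step_width /step_ent; case: ifP => _; rewrite ent_emb.
Qed.

Lemma ent_step_mul U V k n (M : 'M[C]_(N, n)) i j :
  (0 < k <= N)%N -> (0 < i <= N)%N ->
  ent (stepmx U V k *m M) i j =
    if (k <= i < k + step_width k)%N
    then \sum_(t < step_width k) step_ent U V k (i - k).+1 t.+1 * ent M (k + t) j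
    else ent M i j.
Proof.
move=> /andP[k_gt0 le_kN] hi; have := step_width_le le_kN.
rewrite /stepmx /step_width /step_ent; case: ifP => _ le_w.
  by rewrite ent_emb_mul.
by rewrite ent_emb_mul.
Qed.

Lemma ent_mul_step U V k n (M : 'M[C]_(n, N)) i j :
  (0 < k <= N)%N -> (0 < j <= N)%N ->
  ent (M *m stepmx U V k) i j =
    if (k <= j < k + step_width k)%N
    then \sum_(t < step_width k) ent M i (k + t) * step_ent U V k t.+1 (j - k).+1
    else ent M i j.
Proof.
move=> /andP[k_gt0 le_kN] hj; have := step_width_le le_kN.
rewrite /stepmx /step_width /step_ent; case: ifP => _ le_w.
  by rewrite ent_mul_emb.
by rewrite ent_mul_emb.
Qed.

Section Invariants.
Variables (A : 'M[C]_N) (U : nat -> 'M[C]_(r + 1)) (V : forall k, 'M[C]_((N - k).+1)).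
Local Notation S := (elim A U V).

(** The windows of the steps after k lie below row k. *)
Lemma elim_row_above k k' i j : (k <= k' <= N)%N -> (0 < i <= k)%N ->
  ent (S k') i j = ent (S k) i j.
Proof.
move=> /andP[]; elim: k' => [|k' IHk]; first by rewrite leqn0 => /eqP ->.
rewrite leq_eqVlt => /predU1P[-> //|le_kk' lt_k'N hi].
rewrite /= ent_step_mul; [|lia|lia].
by rewrite ifF ?IHk //; lia.
Qed.

(** The windows of the steps 1, ..., k end at row k + r. *)
Lemma elim_row_below k i j : (k <= N - r)%N -> (k + r < i <= N)%N ->
  ent (S k) i j = ent A i j.
Proof.
elim: k => //= k IHk le_kN hi; rewrite ent_step_mul; [|lia|lia].
by rewrite /step_width le_kN ifF ?IHk //; lia.
Qed.

(** Column k is cleared inside its window by assumption and below it by the band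
    condition, because those rows are still rows of A.  A later step mixes
    rows in which the column is already zero. *)
Lemma elim_col_zero : lower_band r A ->
  (forall k i, (0 < k < N)%N -> (k < i < k + step_width k)%N -> ent (S k) i k = 0) ->
  forall k i j, (k < N)%N -> (0 < j <= k)%N -> (j < i <= N)%N -> ent (S k) i j = 0.
Proof.
move=> bandA colS; elim=> [|k IHk] i j lt_kN hj hi; first by lia.
case: (ltnP j k.+1) => [lt_jk|le_kj].
  rewrite /= ent_step_mul; [|lia|lia]; case: ifP => win; last by rewrite IHk //; lia.
  rewrite big1 // => t _; rewrite IHk ?mulr0 //; try lia.
  by have := ltn_ord t; have := step_width_le (ltnW lt_kN); lia.
have {hj le_kj} eq_j : j = k.+1 by lia.
rewrite {}eq_j in hi *.
case win : (i < k.+1 + step_width k.+1)%N; first by rewrite colS //; lia.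
have [le_k lt_i] : (k.+1 <= N - r)%N /\ (k.+1 + r < i)%N.
  by move: win; rewrite /step_width; case: ifP; lia.
rewrite elim_row_below //; last by lia.
have lt_iN : (i.-1 < N)%N by lia.
have := bandA (Ordinal lt_iN) (Ordinal (ltnW lt_kN)).
by rewrite -ent_ord /= prednK; [apply|]; lia.
Qed.

Lemma elim_unit : A \in unitmx ->
  (forall k, (0 < k <= N - r)%N -> U k \is unitarymx) ->
  (forall k, (N - r < k < N)%N -> V k \is unitarymx) ->
  forall k, (k < N)%N -> S k \in unitmx.
Proof.
move=> unitA unitU unitV; elim=> //= k IHk lt_kN; rewrite unitmx_mul IHk ?andbT //; last by lia.
rewrite /stepmx; case: ifP => le_k; apply: emb_unit => //; try lia;
  apply: unitarymx_unit; rewrite trmxC_unitary; [apply: unitU|apply: unitV]; lia.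
Qed.

(** In step k+1 the matrix that U_{k+1}^* multiplies is a block of S_k: Y_k gives
    its first r rows, and the last one is the row k+1+r of A, not yet modified.
    The product is then the block of S_{k+1} in the same place.  The column
    offset c is 1 for Delta and 2 for Z. *)
Lemma head_blk k (Yk : 'M[C]_(r, N - k)) c n : (k < N - r)%N ->
  Yk = blk (S k) k.+1 k.+1 r (N - k) -> (0 < c)%N -> (c + n <= (N - k).+1)%N ->
  (U k.+1)^t* *m col_mx (blk Yk 1 c r n) (blk A (k.+1 + r) (c + k) 1 n) =
  blk (S k.+1) k.+1 (c + k) (r + 1) n.
Proof.
move=> lt_k -> c_gt0 le_cn; rewrite /= /stepmx lt_k blk_emb_mul //; last by lia.
congr (_ *m _); apply/entP => s t hs ht; rewrite ent_col_mx; last by lia.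
rewrite [RHS]ent_blk //; case: ifP => le_s.
  by rewrite !ent_blk; try lia; apply: eq_ent; lia.
rewrite !ent_blk; try lia; rewrite -(@elim_row_below k); try lia.
by apply: eq_ent; lia.
Qed.

Lemma tail_blk k (Yk : 'M[C]_(N - k)) c n : (N - r <= k < N.-1)%N ->
  Yk = blk (S k) k.+1 k.+1 (N - k) (N - k) -> (0 < c)%N -> (c + n <= (N - k).+1)%N ->
  (V k.+1)^t* *m blk Yk 1 c (N - k.+1).+1 n =
  blk (S k.+1) k.+1 (c + k) (N - k.+1).+1 n.
Proof.
move=> hk -> c_gt0 le_cn; rewrite /= /stepmx ifF; last by lia.
rewrite blk_emb_mul //; last by lia.
by congr (_ *m _); rewrite blk_blk; try lia; apply: eq_blk; lia.
Qed.

End Invariants.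

Section QRState.
Variables (A : 'M[C]_N) (U : nat -> 'M[C]_(r + 1)) (V : forall k, 'M[C]_((N - k).+1)).
Variables (Y : forall k, 'M[C]_(r, N - k)) (Y' : forall k, 'M[C]_(N - k)) (T : 'M[C]_N).
Hypothesis qr : qr_procedure A U V Y Y' T.
Local Notation S := (elim A U V).

Lemma qr_head_state k : (k <= N - r)%N -> Y k = blk (S k) k.+1 k.+1 r (N - k).
Proof.
elim: k => [|k IHk] le_k; first exact: (qr_init qr).
have /(qr_head qr) /= [_ _ _ _ <-] : (0 < k.+1 <= N - r)%N by [].
rewrite (head_blk _ (IHk _) (isT : 0 < 2)%N); try lia.
by rewrite blk_blk; try lia; apply: eq_blk; lia.
Qed.

Lemma qr_tail_state k : (N - r <= k < N)%N -> Y' k = blk (S k) k.+1 k.+1 (N - k) (N - k).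
Proof.
elim: k => [|k IHk] hk; first by lia.
case: (ltnP (N - r) k.+1) => [lt_k|le_k].
  have /(qr_tail qr) /= [_ _ _ _ <-] : (N - r + 1 <= k.+1 <= N - 1)%N by lia.
  rewrite (tail_blk _ (IHk _) (isT : 0 < 2)%N); try lia.
  by rewrite blk_blk; try lia; apply: eq_blk; lia.
have eq_k : k.+1 = (N - r)%N by lia.
rewrite eq_k (qr_switch qr) qr_head_state // blk_blk; try lia.
by apply: eq_blk; lia.
Qed.

(** The data recorded at step k, namely x_k, X_k and the zeros below x_k, all
    describe the window of S_k. *)
Lemma qr_step k : (0 < k < N)%N ->
  (forall j, (k <= j <= N)%N -> ent (S k) k j = ent T k j) /\
  (forall i, (k < i < k + step_width k)%N -> ent (S k) i k = 0).
Proof.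
case: k => // k hk.
(* w' is the order of U_{k+1}, either r + 1 or N - k; a separate variable is
   needed because r + 1 is not w.+1 by computation. *)
have conclude w w' (D : 'M[C]_(w', 1)) (Z : 'M[C]_(w', N - k.+1)) :
    step_width k.+1 = w' -> w' = w.+1 ->
    D = blk (S k.+1) k.+1 k.+1 w' 1 -> Z = blk (S k.+1) k.+1 k.+2 w' (N - k.+1) ->
    blk D 1 1 1 1 = (xdiag T k.+1)%:M -> blk D 2 1 w 1 = 0 ->
    blk Z 1 1 1 (N - k.+1) = Xrow T k.+1 ->
  (forall j, (k.+1 <= j <= N)%N -> ent (S k.+1) k.+1 j = ent T k.+1 j) /\
  (forall i, (k.+1 < i < k.+1 + step_width k.+1)%N -> ent (S k.+1) i k.+1 = 0).
  move=> -> eq_w -> ->; rewrite !blk_blk; try lia.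
  move=> /entP eq_diag /entP eq_col /entP eq_row; split=> [j hj|i hi].
    case: (ltngtP k.+1 j) => [lt_kj||<-]; last 1 first.
    - have := eq_diag 1%N 1%N isT isT; rewrite ent_blk // ent_scalar //= !addn0 => -> //.
    - have := eq_row 1%N (j - k.+1)%N isT; rewrite !ent_blk //=; try lia.
      have -> : (k.+2 + 0 + (j - k.+1).-1 = j)%N by lia.
      have -> : (k.+2 + (j - k.+1).-1 = j)%N by lia.
      by rewrite !addn0; apply; lia.
    - by lia.
  have := eq_col (i - k.+1)%N 1%N; rewrite ent_blk //=; try lia.
  have -> : (k.+1 + 1 + (i - k.+1).-1 = i)%N by lia.
  by rewrite !addn0 ent0; apply; lia.
case: (leqP k.+1 (N - r)) => le_k.
  have /(qr_head qr) /= [_ diag col row _] : (0 < k.+1 <= N - r)%N by [].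
  have eqY := qr_head_state (ltnW le_k).
  apply: (conclude _ _ _ _ _ (addn1 r) _ _ diag col row).
  - by rewrite /step_width le_k.
  - by apply: (head_blk le_k eqY (isT : 0 < 1)%N); lia.
  - by apply: (head_blk le_k eqY (isT : 0 < 2)%N); lia.
have /(qr_tail qr) /= [_ diag col row _] : (N - r + 1 <= k.+1 <= N - 1)%N by lia.
have eqY : Y' k = blk (S k) k.+1 k.+1 (N - k) (N - k) by apply: qr_tail_state; lia.
apply: (conclude _ _ _ _ _ erefl _ _ diag col row).
- by rewrite /step_width leqNgt le_k.
- by apply: (tail_blk _ eqY (isT : 0 < 1)%N); lia.
- by apply: (tail_blk _ eqY (isT : 0 < 2)%N); lia.
Qed.

Lemma qr_elim : lower_band r A -> S N.-1 = T.
Proof.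
move=> bandA; apply/entP => i j hi hj.
have colS k i' : (0 < k < N)%N -> (k < i' < k + step_width k)%N -> ent (S k) i' k = 0.
  by move=> hk; apply: (proj2 (qr_step hk)).
case: (ltnP j i) => [lt_ji|le_ij].
  rewrite elim_col_zero //; try lia.
  have [lt_i lt_j] : (i.-1 < N)%N /\ (j.-1 < N)%N by lia.
  have T0 : T (Ordinal lt_i) (Ordinal lt_j) = 0 by apply: (qr_lower qr) => /=; lia.
  by rewrite -[LHS]T0 -ent_ord; apply: eq_ent => /=; lia.
case: (ltnP i N) => [lt_iN|le_Ni].
  by rewrite (@elim_row_above _ _ _ i); try lia; apply: (proj1 (@qr_step i _)); lia.
have [-> ->] : i = N /\ j = N by lia.
have := qr_last qr; rewrite /xdiag => ->.
rewrite qr_tail_state; last by lia.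
by rewrite ent_blk; try lia; rewrite subn1; apply: eq_ent; lia.
Qed.

End QRState.

Section Existence.
Variable A : 'M[C]_N.

Definition reflector n (v : 'cV[C]_n) : 'M[C]_n := xchoose (exists_unitary_reflector v).

Definition headU (M : 'M[C]_N) k : 'M[C]_(r + 1) := reflector (blk M k k (r + 1) 1).
Definition tailV (M : 'M[C]_N) k : 'M[C]_((N - k).+1) := reflector (blk M k k (N - k).+1 1).

(** The unitary matrices are computed from the current matrix, so the matrices
    S_k are built first and the sequence U_k is read off afterwards. *)
Fixpoint qr_state k : 'M[C]_N :=
  if k is k'.+1 then let M := qr_state k' in stepmx (headU M) (tailV M) k *m M else A.

Lemma reflector_unitary n (v : 'cV[C]_n) : reflector v \is unitarymx.
Proof. by case/andP: (xchooseP (exists_unitary_reflector v)). Qed.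

Lemma reflector_zero n (v : 'cV[C]_n) i : (1 < i <= n)%N ->
  ent ((reflector v)^t* *m v) i 1 = 0.
Proof.
case/andP: (xchooseP (exists_unitary_reflector v)) => _ /forallP zero.
case: i => [|i] // /andP[i_gt0 lt_in]; have /implyP/(_ i_gt0)/eqP <- := zero (Ordinal lt_in).
exact: (ent_ord _ (Ordinal lt_in) (0 : 'I_1)).
Qed.

Lemma qr_state_col k i : (0 < k < N)%N -> (k < i < k + step_width k)%N ->
  ent (qr_state k) i k = 0.
Proof.
have conclude w (M : 'M[C]_N) j : (0 < j)%N -> (j + w <= N.+1)%N -> (j < i < j + w)%N ->
    ent (emb N j ((reflector (blk M j j w 1))^t*) *m M) i j = 0.
  move=> j_gt0 le_w hi.
  have /(reflector_zero (blk M j j w 1)) : (1 < (i - j).+1 <= w)%N by lia.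
  rewrite -blk_emb_mul // ent_blk; try lia.
  by move=> <-; apply: eq_ent; lia.
case: k => // k hk; rewrite /= /stepmx /step_width /headU /tailV.
by case: ifP => le_k hi; apply: conclude; lia.
Qed.

Lemma qr_exists : lower_band r A -> exists U V Y Y' T, @qr_procedure C N r A U V Y Y' T.
Proof.
move=> bandA; pose U k := headU (qr_state k.-1) k; pose V k := tailV (qr_state k.-1) k.
have S_state k : qr_state k = elim A U V k by elim: k => //= k <-.
pose S := elim A U V.
have colS k i : (0 < k < N)%N -> (k < i < k + step_width k)%N -> ent (S k) i k = 0.
  by rewrite -[S k]S_state; apply: qr_state_col.
have S_zero := elim_col_zero bandA colS.
pose Y k := blk (S k) k.+1 k.+1 r (N - k).
pose Y' k := blk (S k) k.+1 k.+1 (N - k) (N - k).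
exists U, V, Y, Y', (S N.-1).
have S_row k j : (0 < k < N)%N -> ent (S k) k j = ent (S N.-1) k j.
  by move=> hk; symmetry; apply: elim_row_above; lia.
have S_Xrow k : (0 < k < N)%N -> blk (S k) k k.+1 1 (N - k) = Xrow (S N.-1) k.
  move=> hk; apply/entP => s t hs ht; rewrite /Xrow !ent_blk //.
  by rewrite (_ : k + s.-1 = k)%N; [apply: S_row | lia].
have S_col k n : (0 < k < N)%N -> (k + n < k + step_width k)%N -> blk (S k) k.+1 k n 1 = 0.
  move=> hk lt_n; apply/entP => s t hs ht; rewrite ent_blk // ent0.
  by rewrite (_ : k + t.-1 = k)%N ?colS //; lia.
split=> //.
- case=> // k hk; rewrite /= -/(S k.+1).
  have eqY : Y k = blk (elim A U V k) k.+1 k.+1 r (N - k) by [].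
  rewrite !(head_blk _ eqY (isT : 0 < 1)%N) ?(head_blk _ eqY (isT : 0 < 2)%N); try lia.
  rewrite !blk_blk; try lia.
  split.
  + exact: reflector_unitary.
  + by rewrite blk11 /xdiag -S_row; [congr (_%:M); apply: eq_ent; lia | lia].
  + rewrite -(@S_col k.+1 r); [by apply: eq_blk; lia | by lia |].
    by rewrite /step_width ifT; lia.
  + by rewrite -S_Xrow; [apply: eq_blk; lia | lia].
  + by apply: eq_blk; lia.
- rewrite /Y' /Y blk_blk; try lia; apply: eq_blk; lia.
- case=> [|k] hk; first by exfalso; lia.
  rewrite /= -/(S k.+1).
  have eqY : Y' k = blk (elim A U V k) k.+1 k.+1 (N - k) (N - k) by [].
  rewrite !(tail_blk _ eqY (isT : 0 < 1)%N) ?(tail_blk _ eqY (isT : 0 < 2)%N); try lia.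
  rewrite !blk_blk; try lia.
  split.
  + exact: reflector_unitary.
  + by rewrite blk11 /xdiag -S_row; [congr (_%:M); apply: eq_ent; lia | lia].
  + rewrite -(@S_col k.+1 (N - k.+1)%N); [by apply: eq_blk; lia | by lia |].
    by rewrite /step_width ifF; lia.
  + by rewrite -S_Xrow; [apply: eq_blk; lia | lia].
  + by apply: eq_blk; lia.
- by rewrite /Y' ent_blk; try lia; rewrite subn1; apply: eq_ent; lia.
- move=> i j lt_ji; rewrite -ent_ord; apply: S_zero => /=; have := ltn_ord i; lia.
Qed.

End Existence.
End Elimination.

(** * The inverses of the elimination states and the generators *)

Section Generators.
Variables (C : numClosedFieldType) (N r : nat).
Hypotheses (r_gt0 : (0 < r)%N) (lt_rN : (r < N)%N).
Variables (A : 'M[C]_N) (U : nat -> 'M[C]_(r + 1)) (V : forall k, 'M[C]_((N - k).+1)).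
Variables (Y : forall k, 'M[C]_(r, N - k)) (Y' : forall k, 'M[C]_(N - k)) (T : 'M[C]_N).
Hypotheses (unitA : A \in unitmx) (bandA : lower_band r A).
Hypothesis qr : qr_procedure A U V Y Y' T.
Local Notation S := (elim A U V).
Local Notation H k := (invmx (elim A U V k)).

Local Arguments elim : simpl never.

Lemma elimS k : S k.+1 = stepmx U V k.+1 *m S k.
Proof. by []. Qed.

Lemma qr_unit k : (k < N)%N -> S k \in unitmx.
Proof.
apply: elim_unit => // j hj; first by case: (qr_head qr hj).
by case: (@qr_tail _ _ _ _ _ _ _ _ _ qr j) => //; lia.
Qed.

Lemma qr_col_zero k i j : (k < N)%N -> (0 < j <= k)%N -> (j < i <= N)%N -> ent (S k) i j = 0.
Proof.
by apply: elim_col_zero => // k' i' hk; apply: (proj2 (qr_step r_gt0 lt_rN qr hk)).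
Qed.

Lemma qr_row k i j : (0 < i <= k)%N -> (k < N)%N -> (0 < j <= N)%N -> ent (S k) i j = ent T i j.
Proof.
by move=> hi hk hj; rewrite -(qr_elim r_gt0 lt_rN qr bandA); symmetry; apply: elim_row_above; lia.
Qed.

Lemma qr_diag_neq0 k : (0 < k <= N)%N -> xdiag T k != 0.
Proof.
case: k => // k lt_kN; have : T \in unitmx.
  by rewrite -(qr_elim r_gt0 lt_rN qr bandA) qr_unit //; lia.
rewrite unitmxE -det_tr det_trig; last first.
  by apply/is_trig_mxP => i j lt_ij; rewrite mxE (qr_lower qr).
rewrite unitfE => /prodf_neq0/(_ (Ordinal lt_kN) isT).
by rewrite mxE -ent_ord.
Qed.

Lemma inv_step k : (k.+1 < N)%N -> H k = H k.+1 *m stepmx U V k.+1.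
Proof.
move=> lt_kN; have US1 := qr_unit lt_kN; have US := qr_unit (ltnW lt_kN).
have -> : stepmx U V k.+1 = S k.+1 *m H k by rewrite elimS -mulmxA mulmxV ?mulmx1.
by rewrite mulmxA mulVmx ?mul1mx.
Qed.

(** The first k columns of S_k are upper triangular with nonzero diagonal, so
    comparing the entries (i, j) of H_k S_k = 1 column after column kills
    H_k(i, j) for j < i. *)
Lemma inv_zero k i j : (k < N)%N -> (0 < j <= k)%N -> (j < i <= N)%N -> ent (H k) i j = 0.
Proof.
move=> lt_kN; elim/ltn_ind: j => j IHj hj hi.
have : ent (H k *m S k) i j = 0.
  by rewrite mulVmx ?qr_unit // ent_scalar; [case: eqP => // ?|..]; lia.
have lt_j : (j.-1 < N)%N by lia.
rewrite ent_mul (bigD1 (Ordinal lt_j)) //= big1 => [|l ne_lj].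
  rewrite prednK; last by lia.
  rewrite addr0 qr_row; try lia; move/eqP; rewrite mulf_eq0 => /orP[/eqP //|].
  by rewrite (negPf (qr_diag_neq0 _)); lia.
have {ne_lj} : l.+1 <> j.
  by move=> eq_lj; case/eqP: ne_lj; apply: val_inj; rewrite /= -eq_lj.
case: (ltngtP l.+1 j) => // lt_lj _; first by rewrite IHj ?mul0r //; lia.
by rewrite [X in _ * X]qr_col_zero ?mulr0 //; have := ltn_ord l; lia.
Qed.

(** Row k+1 of S_{k+1} H_k = D_{k+1}, solved for the diagonal term; the entries of
    S_{k+1} left of the diagonal are zero. *)
Lemma inv_first_row k j : (k.+1 < N)%N -> (0 < j <= N)%N ->
  ent (H k) k.+1 j = (xdiag T k.+1)^-1 *
    (ent (stepmx U V k.+1) k.+1 j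
     - \sum_(l < N - k.+1) ent T k.+1 (k.+2 + l) * ent (H k) (k.+2 + l) j).
Proof.
move=> lt_kN hj.
have : ent (S k.+1 *m H k) k.+1 j = ent (stepmx U V k.+1) k.+1 j.
  by rewrite elimS -mulmxA mulmxV ?mulmx1 // qr_unit // ltnW.
rewrite ent_mul (bigD1 (Ordinal (ltnW lt_kN))) //= qr_row; try lia.
move=> <-; rewrite (_ : \sum_(i < N | _) _ =
    \sum_(l < N - k.+1) ent T k.+1 (k.+2 + l) * ent (H k) (k.+2 + l) j).
  by rewrite addrK mulKf // qr_diag_neq0 //; lia.
transitivity (\sum_(l < N | (k.+1 <= l < k.+1 + (N - k.+1))%N)
    ent T k.+1 l.+1 * ent (H k) l.+1 j); last first.
  by rewrite (sum_window (fun l => ent T k.+1 l.+1 * ent (H k) l.+1 j)) //; lia.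
rewrite big_mkcond [RHS]big_mkcond; apply: eq_bigr => l _.
rewrite -val_eqE /=; have lt_lN := ltn_ord l.
case: (ltngtP l k) => [lt_lk|lt_kl|//] /=.
  by rewrite qr_col_zero ?mul0r //; lia.
by rewrite ifT ?[ent _ k.+1 l.+1](@qr_row k.+1) //; lia.
Qed.

(** This is H_k = H_{k+1} D_{k+1} read in column k+1+t of the window; the term of the
    first row of U_{k+1}^* is multiplied by H_{k+1}(i, k+1) = 0. *)
Lemma inv_below k i t : (k.+1 < N)%N -> (k.+1 < i <= N)%N -> (t < step_width N r k.+1)%N ->
  ent (H k) i (k.+1 + t) =
  \sum_(s < (step_width N r k.+1).-1) ent (H k.+1) i (k.+2 + s) * step_ent U V k.+1 s.+2 t.+1.
Proof.
move=> lt_kN hi lt_t; have le_w := step_width_le r_gt0 lt_rN (ltnW lt_kN).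
rewrite inv_step // ent_mul_step //; try lia.
rewrite ifT; last by lia.
rewrite (_ : (k.+1 + t - k.+1)%N = t); last by lia.
case: (step_width N r k.+1) lt_t le_w => // w _ le_w.
rewrite big_ord_recl /= addn0 inv_zero ?mul0r ?add0r //; try lia.
by apply: eq_bigr => s _; rewrite /bump /= add1n addnS.
Qed.

(** Block form of the previous identity.  Here a stands for any group of columns,
    after the first t0 ones, of U_{k+1}^* without its first row: a_U for t0 = 0,
    q_U for t0 = r. *)
Lemma inv_cols k i m n w t0 (a : 'M[C]_(w, n)) :
  (k.+1 < N)%N -> (k.+1 < i)%N -> (i + m <= N.+1)%N ->
  step_width N r k.+1 = w.+1 -> (t0 + n <= w.+1)%N ->
  (forall s t, (0 < s <= w)%N -> (0 < t <= n)%N ->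
     ent a s t = step_ent U V k.+1 s.+1 (t0 + t)) ->
  blk (H k) i (k.+1 + t0) m n = blk (H k.+1) i k.+2 m w *m a.
Proof.
move=> lt_kN lt_ki le_m eq_w le_n aE; apply/entP => s t hs ht.
rewrite ent_blk // (_ : (k.+1 + t0 + t.-1 = k.+1 + (t0 + t.-1))%N); last by lia.
rewrite inv_below; try lia; rewrite eq_w ent_mul.
apply: eq_bigr => l _; rewrite ent_blk //; last exact: ltn_ord.
by rewrite aE //; [congr (_ * step_ent _ _ _ _ _); lia | exact: ltn_ord].
Qed.

(** The step P_{k+1} -> P_k of the backward recursion, common to its two phases. *)
Lemma inv_prepend k n c (p : 'rV[C]_c) (Pa : 'M[C]_(n, c)) :
  (k.+1 < N)%N -> n = (N - k.+1)%N -> (c <= step_width N r k.+1)%N ->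
  (forall t, (0 < t <= c)%N -> ent p 1 t = step_ent U V k.+1 1 t) ->
  Pa = blk (H k) k.+2 k.+1 n c ->
  col_mx ((xdiag T k.+1)^-1 *: (p - blk (Xrow T k.+1) 1 1 1 n *m Pa)) Pa =
  blk (H k) k.+1 k.+1 n.+1 c.
Proof.
move=> lt_kN eq_n; subst n => le_c pE ->; have le_w := step_width_le r_gt0 lt_rN (ltnW lt_kN).
apply/entP => s t hs ht.
rewrite ent_col_mx; last by lia.
rewrite [RHS]ent_blk //; case: ifP => le_s; last first.
  by rewrite ent_blk; try lia; apply: eq_ent; lia.
have -> : s = 1%N by lia.
rewrite addn0 inv_first_row; try lia.
rewrite ent_scale ent_sub pE // ent_stepmx; try lia.
rewrite ifT; last by lia.
congr (_ * (_ - _)); first by congr step_ent; lia.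
rewrite ent_mul; apply: eq_bigr => l _.
have lt_l := ltn_ord l.
rewrite /Xrow !ent_blk //; try lia.
by congr (_ * _); apply: eq_ent; lia.
Qed.

(** For k = N - m this reads P_k = H_{k-1}(k:N, k:N).  In this phase the window
    reaches the last column, so P_k is the whole trailing block. *)
Lemma Ptail_inv m : (m < r)%N -> Ptail V T m = blk (H (N - m.+1)) (N - m) (N - m) m.+1 m.+1.
Proof.
elim: m => [|m IHm] lt_mr.
  rewrite /= blk11 subn0 subn1; congr (_%:M).
  have := qr_elim r_gt0 lt_rN qr bandA => ST.
  have : ent (S N.-1 *m H N.-1) N N = 1.
    by rewrite mulmxV ?qr_unit ?ent_scalar ?eqxx //; lia.
  have lt_N : (N.-1 < N)%N by lia.
  rewrite ST ent_mul (bigD1 (Ordinal lt_N)) //= big1 => [|l ne_l].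
    rewrite prednK; last by lia.
    by rewrite addr0 => /(canRL (mulKf (qr_diag_neq0 _))) ->; [rewrite mulr1 | lia].
  have T0 : T (Ordinal lt_N) l = 0.
    apply: (qr_lower qr) => /=; have := ltn_ord l; move/eqP: ne_l => ne_l.
    have : nat_of_ord l <> N.-1 by move=> eq_l; apply: ne_l; apply: val_inj.
    by lia.
  by rewrite (_ : ent T N l.+1 = 0) ?mul0r // -[RHS]T0 -ent_ord; apply: eq_ent => /=; lia.
set k := (N - m.+2)%N; have eq_k : (N - m.+1)%N = k.+1 by rewrite /k; lia.
rewrite /= eq_k.
have eq_w : step_width N r k.+1 = m.+2 by rewrite /step_width ifF; lia.
have entV s t : step_ent U V k.+1 s t = ent ((V k.+1)^t*) s t.
  by rewrite /step_ent ifF //; lia.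
apply: inv_prepend; try lia.
  by move=> t ht; rewrite /pV !ent_blk //; [rewrite entV; apply: eq_ent | ]; lia.
rewrite IHm; last by lia.
have := @inv_cols k k.+2 m.+1 m.+2 m.+1 0 (blk (aV V k.+1) 1 1 m.+1 m.+2).
rewrite addn0 => ->; try lia; first by rewrite eq_k; congr (_ *m _); apply: eq_blk; lia.
by move=> s t hs ht; rewrite /aV !ent_blk //; [rewrite entV; apply: eq_ent | ..]; lia.
Qed.

Lemma gen_P_inv : gen_P r V T = blk (H (N - r)) (N - r).+1 (N - r).+1 r r.
Proof.
rewrite /gen_P Ptail_inv; last by lia.
rewrite (_ : r.-1.+1 = r) ?blk_blk; try lia.
by apply: eq_blk; lia.
Qed.

Lemma step_ent_head k s t : (k <= N - r)%N -> step_ent U V k s t = ent ((U k)^t*) s t.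
Proof. by rewrite /step_ent => ->. Qed.

Lemma step_width_head k : (k <= N - r)%N -> step_width N r k = r.+1.
Proof. by rewrite /step_width => ->; rewrite addn1. Qed.

Lemma inv_cols_a k i m : (k < N - r)%N -> (k.+1 < i)%N -> (i + m <= N.+1)%N ->
  blk (H k) i k.+1 m r = blk (H k.+1) i k.+2 m r *m aU U k.+1.
Proof.
move=> lt_k lt_ki le_m; have := @inv_cols k i m r r 0 (aU U k.+1).
rewrite addn0; apply; rewrite ?step_width_head //; try lia.
by move=> s t hs ht; rewrite /aU ent_blk // step_ent_head //; apply: eq_ent; lia.
Qed.

(** For k = N - r + 1 - n this reads P_k = H_{k-1}(k:N, k:k+r-1): for n > 0
    these are all columns of the window but the last, which q(k) encodes
    ([inv_col_q]). *)
Lemma Phead_inv n : (n <= N - r)%N ->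
  Phead U V T n = blk (H (N - r - n)) (N - r - n).+1 (N - r - n).+1 (n + r) r.
Proof.
elim: n => [|n IHn] le_n; first by rewrite /= gen_P_inv subn0.
set k := (N - r - n.+1)%N; have eq_k : (N - r - n)%N = k.+1 by rewrite /k; lia.
(* n.+1 + r computes to (n + r).+1, the number of rows that col_mx produces. *)
rewrite -[RHS]/(blk (H k) k.+1 k.+1 (n + r).+1 r).
rewrite /= (_ : N - r + 1 - n.+1 = k.+1)%N; last by rewrite /k; lia.
apply: (@inv_prepend k (n + r)); rewrite ?step_width_head; try lia.
  by move=> t ht; rewrite /pU ent_blk // step_ent_head; [apply: eq_ent | ]; lia.
rewrite IHn; last by lia.
by rewrite eq_k [RHS]inv_cols_a //; lia.
Qed.

Lemma gen_p_inv k : (0 < k <= N - r)%N -> gen_p U V T k = blk (H k.-1) k k 1 r.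
Proof.
move=> hk; rewrite /gen_p Phead_inv; last by lia.
rewrite blk_blk; try lia.
have -> : (N - r - (N - r + 1 - k) = k.-1)%N by lia.
by apply: eq_blk; lia.
Qed.

Lemma inv_cols_aprod j k i m : (j <= k <= N - r)%N -> (k < i)%N -> (i + m <= N.+1)%N ->
  blk (H j) i j.+1 m r = blk (H k) i k.+1 m r *m aprod (aU U) k.+1 j.
Proof.
case/andP; elim: k => [|k IHk].
  by rewrite leqn0 => /eqP -> *; rewrite /aprod /index_iota /= big_nil mulmx1.
rewrite leq_eqVlt => /predU1P[-> *|le_jk le_k lt_ki le_m].
  by rewrite /aprod /index_iota subnn /= big_nil mulmx1.
by rewrite IHk 1?inv_cols_a ?aprodS ?mulmxA //; lia.
Qed.

(** The window of step k ends at column k + r. *)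
Lemma inv_cols_right k i c m n : (k <= N - r)%N -> (k + r < c)%N -> (c + n <= N.+1)%N ->
  (0 < i)%N -> (i + m <= N.+1)%N -> blk (H 0) i c m n = blk (H k) i c m n.
Proof.
move=> + + le_n i_gt0 le_m; elim: k => // k IHk le_k lt_c.
rewrite IHk; try lia; apply/entP => s t hs ht; rewrite !ent_blk //.
rewrite inv_step; last by lia.
rewrite ent_mul_step; try lia.
by rewrite step_width_head // ifF //; lia.
Qed.

(** Column r+j is the last one of the window of step j, so the steps before j leave
    it alone and step j multiplies by q_U(j). *)
Lemma inv_col_q j i m : (0 < j <= N - r)%N -> (j < i)%N -> (i + m <= N.+1)%N ->
  blk (H 0) i (r + j) m 1 = blk (H j) i j.+1 m r *m qU U j.
Proof.
case: j => // j hj lt_ji le_m.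
rewrite (@inv_cols_right j); try lia.
rewrite (_ : r + j.+1 = j.+1 + r)%N; last by lia.
apply: inv_cols; rewrite ?step_width_head //; try lia.
by move=> s t hs ht; rewrite /qU ent_blk // step_ent_head //; apply: eq_ent; lia.
Qed.

Lemma inverse_green_generators :
  lower_green_generators (gen_p U V T) (qU U) (aU U) (gen_P r V T) (invmx A).
Proof.
rewrite -[A]/(S 0); split.
- move=> [|i] // hi; rewrite gen_p_inv // (@inv_cols_aprod 0 i) //; lia.
- move=> [|i] j hj hi; [by lia|rewrite gen_p_inv; last by lia].
  rewrite inv_col_q; try lia.
  by rewrite (@inv_cols_aprod j i) //; lia.
- by rewrite addn1 gen_P_inv (@inv_cols_aprod 0 (N - r)) //; lia.
- move=> j hj; rewrite addn1 gen_P_inv inv_col_q; try lia.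
  by rewrite (@inv_cols_aprod j (N - r)) //; lia.
Qed.

End Generators.

Theorem theorem4p3 (R : realType) (N r : nat) (A : 'M[R[i]]_N)
    (hr : (0 < r)%N) (hN : (r < N)%N)
    (hA : A \in unitmx) (hband : lower_band r A) :
  (exists (U : nat -> 'M[R[i]]_(r + 1)) (V : forall k : nat, 'M[R[i]]_((N - k).+1))
          (Y : forall k : nat, 'M[R[i]]_(r, N - k)) (Y' : forall k : nat, 'M[R[i]]_(N - k))
          (T : 'M[R[i]]_N),
     qr_procedure A U V Y Y' T) /\
  (forall (U : nat -> 'M[R[i]]_(r + 1)) (V : forall k : nat, 'M[R[i]]_((N - k).+1))
          (Y : forall k : nat, 'M[R[i]]_(r, N - k)) (Y' : forall k : nat, 'M[R[i]]_(N - k))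
          (T : 'M[R[i]]_N),
     qr_procedure A U V Y Y' T ->
     (forall k : nat, (1 <= k <= N)%N -> xdiag T k != 0) /\
     lower_green_generators (gen_p U V T) (qU U) (aU U) (gen_P r V T) (invmx A)).
Proof.
split=> [|U V Y Y' T qr]; first exact: qr_exists.
split=> [k|]; first exact: (qr_diag_neq0 hr hN hA hband qr).
exact: (inverse_green_generators hr hN hA hband qr).
Qed.
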